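(* Let $G=([p],E)$ be a star (a tree on $p$ nodes in which one node is adjacent to all the others and there are no other edges). Then $\operatorname{CIM}_G$ is a simplex of dimension $2^{p-1}-p$.
   Context: $[p]=\{1,\dots,p\}$. For a DAG $\mathcal D$ on $[p]$ the characteristic imset $c_{\mathcal D}$ is the vector indexed by all $S\subseteq[p]$, $|S|\ge2$, with $c_{\mathcal D}(S)=1$ if there is $i\in S$ such that all elements of $S\setminus\{i\}$ are parents of $i$ in $\mathcal D$, and $0$ otherwise. $\operatorname{CIM}_G=\operatorname{conv}(c_{\mathcal D}:\mathcal D\text{ a DAG on }[p]\text{ with skeleton (underlying undirected graph) }G)$. *)

(* Defs.v *)
From mathcomp Require Import all_boot all_order all_algebra.
From mathcomp Require Import boolp classical_sets reals convex.

Set Implicit Arguments.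
Unset Strict Implicit.
Unset Printing Implicit Defensive.

Import GRing.Theory.
Local Open Scope ring_scope.
Local Open Scope classical_set_scope.

(* The vertex set [p] is 'I_p. *)

Definition simple_graph p (G : rel 'I_p) : Prop := symmetric G /\ irreflexive G.

(* In a simple graph, a simple closed walk of size at most 2 is empty or runs
   back and forth along one edge. *)
Definition is_tree p (G : rel 'I_p) : Prop :=
  [/\ simple_graph G, (0 < p)%N, (forall i j, connect G i j) &
      (forall c : seq 'I_p, ucycle G c -> (size c <= 2)%N)].

Definition is_star p (G : rel 'I_p) : Prop :=
  is_tree G /\
  exists z : 'I_p,
    (forall i, i != z -> G z i) /\ (forall i j, G i j -> i = z \/ j = z).

(* A directed graph is a relation, with D j i standing for the edge j -> i.
   [cycle D c] allows repeated vertices, and c = [:: i] is a loop at i. *)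
Definition is_dag p (D : rel 'I_p) : Prop :=
  forall c : seq 'I_p, cycle D c -> c = [::].

Definition parents p (D : rel 'I_p) (i : 'I_p) : {set 'I_p} := [set j | D j i]%SET.

Definition skeleton p (D : rel 'I_p) : rel 'I_p := fun i j => D i j || D j i.

Definition imset_index p := {S : {set 'I_p} | (2 <= #|S|)%N}.

(* R^o is R as a vector space over itself, which makes this a vectType R. *)
Definition imset_space (R : realType) p := {ffun imset_index p -> R^o}.

Definition char_imset (R : realType) p (D : rel 'I_p) : imset_space R p :=
  [ffun S : imset_index p =>
     [exists i in val S, val S :\ i \subset parents D i]%:R].

Definition convex_hull (R : realType) (V : lmodType R) (A : set V) : set V :=
  smallest (@convex_set R V) A.

Definition CIM (R : realType) p (G : rel 'I_p) : set (imset_space R p) :=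
  convex_hull [set char_imset R D | D in [set D | is_dag D /\ skeleton D =2 G]].
Arguments CIM R {p} G.

Definition affinely_independent (R : realType) (V : vectType R) d
    (v : 'I_d.+1 -> V) : Prop :=
  free [seq v (lift ord0 i) - v ord0 | i <- enum 'I_d].

Definition is_simplex (R : realType) (V : vectType R) (d : nat) (P : set V) : Prop :=
  exists v : 'I_d.+1 -> V, affinely_independent v /\ P = convex_hull (range v).

(* Main.v *)
Require Import Defs.
From mathcomp Require Import all_boot all_order all_algebra.
From mathcomp Require Import boolp classical_sets reals.
From mathcomp Require Import fintype finset.

(** A DAG whose skeleton is the star with centre [z] is determined by the set
    [A] of parents of [z], and its imset is 1 exactly at the sets [S] containing
    [z] with [S \ z] a subset of [A] or a singleton. So all [A] with at most one
    element give the same vertex, while the [2^(p-1) - p] sets [A] with at least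
    two elements give vertices whose coordinates at [S = z |: B], [2 <= #|B|],
    form the inclusion matrix [B \subset A], which is unitriangular. *)

Set Implicit Arguments.
Unset Strict Implicit.
Unset Printing Implicit Defensive.

Import GRing.Theory.
Local Open Scope ring_scope.

Section Star.
Variable p : nat.
Implicit Types (z i j : 'I_p) (A B S : {set 'I_p}) (D G : rel 'I_p).

Definition star_rel z : rel 'I_p := fun i j => (i == z) != (j == z).

Lemma is_star_rel G : is_star G -> exists z, G =2 star_rel z.
Proof.
case=> -[[Gsym Girr] _ _ _] [z [Gz zG]]; exists z => i j; rewrite /star_rel.
have [->|iz] := eqVneq i z; have [->|jz] := eqVneq j z.
- by rewrite Girr.
- by rewrite Gz.
- by rewrite Gsym Gz.
- by apply/negP => /zG[] /eqP; apply/negP.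
Qed.

Lemma ranked_is_dag (r : 'I_p -> nat) D :
  (forall i j, D i j -> (r i < r j)%N) -> is_dag D.
Proof.
move=> Dr [//|x c] /= /(sub_path Dr) xc.
have /allP/(_ x) : all (fun y => r x < r y)%N (rcons c x).
  apply: (@order_path_min _ (fun x y => r x < r y)%N) xc.
  by move=> u v w; apply: ltn_trans.
by rewrite mem_rcons mem_head ltnn => /(_ isT).
Qed.

(** The first disjunct gives the edges into the centre, the second those from the centre to the
    leaves outside [A]. *)
Definition star_orient z A : rel 'I_p := fun j i =>
  (i == z) && (j \in A) || [&& j == z, i != z & i \notin A].

Lemma star_orient_dag z A : z \notin A -> is_dag (star_orient z A).
Proof.
move=> zA.
(* A topological order: parents of the centre, then the centre, then its children. *)
apply: (@ranked_is_dag (fun i => if i \in A then 0 else if i == z then 1 else 2)%N).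
move=> i j /orP[/andP[/eqP-> iA]|/and3P[/eqP-> jz /negPf jA]].
  by rewrite iA (negPf zA) eqxx.
by rewrite jA (negPf jz) (negPf zA) eqxx.
Qed.

Lemma star_orient_skeleton z A :
  z \notin A -> skeleton (star_orient z A) =2 star_rel z.
Proof.
move=> zA i j; rewrite /skeleton /star_orient /star_rel.
have [->|iz] := eqVneq i z; have [->|jz] := eqVneq j z => //=.
- by rewrite (negPf zA).
- by case: (j \in A).
- by case: (i \in A).
Qed.

Lemma parents_star_orient z A : parents (star_orient z A) z = A.
Proof. by apply/setP => j; rewrite inE /star_orient eqxx /= andbF orbF. Qed.

Lemma center_notin_parents z D :
  skeleton D =2 star_rel z -> z \notin parents D z.
Proof.
by move=> Dz; have := Dz z z; rewrite inE /skeleton /star_rel orbb eqxx => ->.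
Qed.

Variable R : realType.

Definition star_imset z A : imset_space R p :=
  [ffun S : imset_index p =>
     ((z \in val S) && ((val S :\ z \subset A) || (#|val S| == 2)))%:R].

Lemma char_imset_star z D : skeleton D =2 star_rel z ->
  char_imset R D = star_imset z (parents D z).
Proof.
move=> Dz; apply/ffunP => -[S S2]; rewrite !ffunE /=; congr (_%:R).
have par i : i != z -> parents D i \subset [set z].
  move=> iz; apply/subsetP => j; rewrite !inE => Dji.
  by have := Dz j i; rewrite /skeleton Dji /star_rel (negPf iz); case: (j == z).
congr nat_of_bool; apply/existsP/andP => [[i /andP[iS Si]]|[zS /orP[Sz|S2']]].
- have [iz|iz] := eqVneq i z; first by rewrite -iz iS Si.
  (* A leaf has no parent but the centre, so [S] must be the edge joining [i] and [z]. *)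
  have Siz := subset_trans Si (par i iz).
  have := cardsD1 i S; rewrite iS => cS.
  have /eqP Sz : S :\ i == [set z].
    by rewrite eqEcard Siz cards1 -ltnS -[(#|_|).+1]add1n -cS.
  rewrite cS Sz cards1 orbT; split=> //.
  by have := set11 z; rewrite -Sz => /setD1P[].
- by exists z; rewrite zS Sz.
(* Here [S] is an edge of the star; its head, [z] or [i] according to the orientation, is the
   witness. *)
have /cards1P[i Sz] : #|S :\ z| == 1%N.
  by move: S2'; rewrite (cardsD1 z) zS.
have /setD1P[iz iS] : i \in S :\ z by rewrite Sz set11.
have := Dz i z; rewrite /skeleton /star_rel eqxx (negPf iz) => /orP[Diz|Dzi].
  by exists z; rewrite zS Sz sub1set inE.
exists i; rewrite iS /=; apply/subsetP => j /setD1P[ji jS].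
rewrite inE; have [->//|jz] := eqVneq j z.
have : j \in S :\ z by rewrite !inE jz.
by rewrite Sz inE (negPf ji).
Qed.

(** If [S] contains [z] and [S :\ z] lies in a set of at most one element, then [S] already has
    exactly two elements, so the inclusion test adds nothing. *)
Lemma star_imset_small z A : (#|A| <= 1)%N -> star_imset z A = star_imset z set0.
Proof.
suff small B (S : imset_index p) : (#|B| <= 1)%N -> z \in val S ->
    (val S :\ z \subset B) || (#|val S| == 2) = (#|val S| == 2).
  move=> A1; apply/ffunP => S; rewrite !ffunE.
  by case zS: (z \in val S); rewrite //= !small // cards0.
move=> B1 zS; apply/orb_idl => /subset_leq_card SB.
rewrite eqn_leq (valP S) andbT (cardsD1 z) zS ltnS.
exact: leq_trans SB B1.
Qed.

Definition star_big z : {set {set 'I_p}} :=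
  [set A : {set 'I_p} | (A \subset [set~ z]) && (1 < #|A|)%N].

Lemma card_star_big z : #|star_big z| = (2 ^ p.-1 - p)%N.
Proof.
have p_gt0 : (0 < p)%N by apply: leq_ltn_trans (ltn_ord z).
have cz : #|[set~ z]| = p.-1 by rewrite cardsC1 card_ord.
rewrite -{1}cz -card_powerset.
pose draws k := [set A : {set 'I_p} | (A \subset [set~ z]) && (#|A| == k)].
(* The subtracted [p] counts the small sets of leaves: the empty one and the [p.-1] singletons. *)
have pE : p = #|draws 0 :|: draws 1|.
  rewrite cardsU !cards_draws cz bin0 bin1 disjoint_setI0 ?cards0 ?subn0.
    by rewrite add1n prednK.
  by apply/pred0P => A /=; rewrite !inE; case: (A \subset _); case: #|A| => [|[]].
rewrite [X in (_ - X)%N]pE -cardsDS.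
  by apply: eq_card => A; rewrite !inE; case: (A \subset _); case: #|A| => [|[]].
by apply/subsetP => A; rewrite !inE; case: (A \subset _).
Qed.

(** At such a coordinate the two-element case is excluded and the base point vanishes, so only the
    inclusion test survives. *)
Lemma star_imset_subE z A B (zB : (2 <= #|z |: B|)%N) :
    B \in star_big z ->
  (star_imset z A - star_imset z set0) (exist _ (z |: B) zB) = (B \subset A)%:R.
Proof.
rewrite !inE => /andP[BC B2].
have zNB : z \notin B by apply/negP => /(subsetP BC); rewrite !inE eqxx.
rewrite !ffunE /= setU11 setU1K //= cardsU1 zNB add1n eqSS.
have /negPf-> : #|B| != 1%N by rewrite neq_ltn B2 orbT.
have /negPf-> : ~~ (B \subset set0) by rewrite subset0 -card_gt0 ltnW.
by rewrite !orbF subr0.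
Qed.

Lemma free_star_imset z :
  free [seq star_imset z A - star_imset z set0 | A <- enum (star_big z)].
Proof.
pose F A : imset_space R p := star_imset z A - star_imset z set0.
apply/(freeP (X := map_tuple F (enum_tuple (star_big z)))) => k k0 i.
have kE (S : imset_index p) : \sum_j k j * F (enum_val j) S = 0.
  have /ffunP/(_ S) := k0; rewrite sum_ffunE ffunE => k0S.
  rewrite -[RHS]k0S; apply: eq_bigr => j _.
  by rewrite (nth_map set0) -?(enum_val_nth set0) -?cardE ?ltn_ord // [RHS]ffunE.
apply/eqP/negPn/negP => ki.
(* Unitriangularity enters through a set of maximal size among those with nonzero coefficient. At
   its coordinate only sets containing it contribute, and any larger one has coefficient 0, which
   forces [k m = 0]. *)
have [m km mmax] :=
  arg_maxnP (P := fun l => k l != 0) (fun l => #|enum_val l|) ki.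
have zm : (2 <= #|z |: enum_val m|)%N.
  have := enum_valP m; rewrite inE => /andP[_ /leq_trans]; apply.
  exact/subset_leq_card/subsetUr.
have := kE (exist _ (z |: enum_val m) zm); rewrite (bigD1 m) //= big1 => [|j jm].
  by rewrite /F star_imset_subE ?enum_valP // subxx mulr1 addr0 => /eqP; apply/negP.
rewrite /F star_imset_subE ?enum_valP //.
have [->|kj] := eqVneq (k j) 0; first by rewrite mul0r.
case: (boolP (_ \subset _)) => [mj|]; last by rewrite mulr0.
have /eqP/enum_val_inj mj' : enum_val m == enum_val j.
  by rewrite eqEcard mj; apply: mmax.
by rewrite mj' eqxx in jm.
Qed.

End Star.

Theorem lemma1p9 (R : realType) (p : nat) (G : rel 'I_p) (hG : is_star G) :
  is_simplex (2 ^ p.-1 - p)%N (CIM R G).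
Proof.
have [z Gz] := is_star_rel hG.
pose s := enum (star_big z).
have sE : size s = (2 ^ p.-1 - p)%N by rewrite -cardE card_star_big.
(* Vertex 0 comes from [set0] and stands for all small parent sets; vertex [i.+1] comes from the
   [i]-th big set. The list has exactly as many entries as there are vertices, so the default of
   [nth] is never reached. *)
exists (fun i => star_imset R z (nth set0 (set0 :: s) i)); split.
  rewrite /affinely_independent.
  rewrite (_ : map _ _ = [seq star_imset R z A - star_imset R z set0 | A <- s]).
    exact: free_star_imset.
  rewrite -[in RHS](mkseq_nth set0 s) /mkseq sE -val_enum_ord -!map_comp.
  by apply: eq_map => i.
(* It suffices that the two generating sets coincide. *)
rewrite /CIM; congr convex_hull; apply/seteqP; split=> [_ [D [_ DG] <-]|_ [i _ <-]].
  have Dz : skeleton D =2 star_rel z by move=> i j; rewrite DG Gz.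
  rewrite (char_imset_star R Dz).
  have zA := center_notin_parents Dz.
  have [A1|A2] := leqP #|parents D z| 1.
    by exists ord0 => //; apply/esym/star_imset_small.
  have As : parents D z \in s.
    rewrite mem_enum inE A2 andbT; apply/subsetP => j jA; rewrite !inE.
    by apply: contraNneq zA => jz; rewrite -{1}jz.
  have iA : (index (parents D z) s < 2 ^ p.-1 - p)%N by rewrite -sE index_mem.
  by exists (lift ord0 (Ordinal iA)); rewrite //= nth_index.
set A := nth _ _ _.
have zA : z \notin A.
  have : A \in set0 :: s by rewrite mem_nth //= sE.
  rewrite in_cons => /orP[/eqP->|]; first by rewrite in_set0.
  rewrite mem_enum inE => /andP[/subsetP AC _].
  by apply/negP => /AC; rewrite !inE eqxx.
have Dz := star_orient_skeleton zA.
exists (star_orient z A).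
  by split; [exact: star_orient_dag | move=> i' j; rewrite Dz Gz].
by rewrite (char_imset_star R Dz) parents_star_orient.
Qed.
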